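(* Let $R$ be a commutative finite chain ring of nilpotency index $e$ and residue field $\mathbb{F}_q$, and let $\gamma$ be a generator of the maximal ideal of $R$. Then \[c_n(R,\gamma^s)=q^{(e-1)(n-1)}(q-1)^{n-1}\binom{n+s-1}{n-1}\] for all integers $1\leq s<e$ and for all positive divisors $n$ of $q-1$.
   Context: A commutative finite chain ring (CFCR) is a finite commutative ring $R$ with identity $1\neq 0$ whose ideals are linearly ordered by inclusion. Its unique maximal ideal is principal; for a generator $\gamma$ of it, the nilpotency index of $R$ is the smallest positive integer $e$ with $\gamma^e=0$, and the residue field is $R/\gamma R\cong\mathbb{F}_q$ for a prime power $q$. An $n\times n$ circulant matrix over a commutative ring $S$ is a matrix $\mathrm{cir}(a_1,\dots,a_n)$ with first row $(a_1,a_2,\dots,a_n)$, $a_i\in S$, in which each subsequent row is the right cyclic shift of the previous row. For $a\in S$, $c_n(S,a)$ denotes the number of $n\times n$ circulant matrices over $S$ with determinant $a$. *)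

(* Defs.v *)
From mathcomp Require Import all_boot all_algebra.

Set Implicit Arguments.
Unset Strict Implicit.
Unset Printing Implicit Defensive.

Import GRing.Theory.
Local Open Scope ring_scope.

Section FiniteChainRings.
Variable R : finComNzRingType.

(* The library's [idealr_closed] excludes the unit ideal; this does not. *)
Definition is_ideal (I : {set R}) : Prop :=
  [/\ 0 \in I,
      {in I &, forall x y, x + y \in I} &
      forall a, {in I, forall x, a * x \in I}].

(* The finite commutative rings with 1 != 0 are the [finComNzRingType]s. *)
Definition chain_ring : Prop :=
  forall I J : {set R}, is_ideal I -> is_ideal J -> I \subset J \/ J \subset I.

Definition maximal_ideal (M : {set R}) : Prop :=
  [/\ is_ideal M, M != [set: R] &
      forall I : {set R},
        is_ideal I -> M \subset I -> I = M \/ I = [set: R]].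

Definition principal_ideal (g : R) : {set R} := [set g * x | x : R].

Definition nilpotency_index (g : R) (e : nat) : Prop :=
  [/\ (0 < e)%N, g ^+ e = 0 &
      forall k : nat, (0 < k)%N -> g ^+ k = 0 -> (e <= k)%N].

(* R / gR is isomorphic to F.  The quotient [{ideal_quot I}] needs a bundled
   proper ideal I, whose underlying set is required to be gR. *)
Definition residue_field (g : R) (F : finFieldType) : Prop :=
  exists (I : idealr R) (f : {rmorphism {ideal_quot I} -> F}),
    (forall x : R, (x \in I) = (x \in principal_ideal g)) /\ bijective f.

End FiniteChainRings.

Section Circulant.
Variable S : finComNzRingType.

(* [ord_pred] is the cyclic predecessor on 'I_n. *)
Definition right_shift n (v : 'rV[S]_n) : 'rV[S]_n :=
  \row_j v 0 (ord_pred j).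

Definition cir n (a : 'rV[S]_n) : 'M[S]_n :=
  \matrix_(i < n) iter i (@right_shift n) a.

Definition num_circulant n (d : S) : nat :=
  #|[set A : 'M[S]_n | [exists a : 'rV[S]_n, A == cir a] && (\det A == d)]|.

End Circulant.

(* Main.v *)
(* Let pi : R -> F be the residue map.  A primitive n-th root of unity z of F
   lifts to w in R with w ^+ n = 1: if pi x = z, take w = x ^+ (q ^ e), because
   raising to the power q improves congruences modulo a power of gamma.  As
   w ^+ k - 1 (0 < k < n) and n%:R are units, the discrete Fourier transform
   a |-> (\sum_j a_j w ^+ (j * k))_k is a bijection of R^n, and it diagonalizes
   circulant matrices.  So the circulant matrices of determinant d correspond
   to the n-tuples of elements of R with product d.
   For d = gamma ^+ s these are counted by induction on n.  If the first entry b
   is gamma ^+ i times a unit, there are |Ann (gamma ^+ i)| choices for the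
   product of the others, all of them of valuation s - i; and the number of such
   b times |Ann (gamma ^+ i)| is the number of units, for every i < e. *)
Require Import Defs.
From mathcomp Require Import all_boot all_algebra.
From HB Require Import structures.
From mathcomp Require Import all_solvable all_field.

Set Implicit Arguments.
Unset Strict Implicit.
Unset Printing Implicit Defensive.

Import GRing.Theory.
Local Open Scope ring_scope.
Local Open Scope quotient_scope.

(** * Residue map, finite field facts and a binomial sum *)

Lemma residue_morphism (R : finComNzRingType) (g : R) (F : finFieldType) :
  residue_field g F ->
  exists pi : {rmorphism R -> F},
    (forall y, exists x, pi x = y) /\
    (forall x, pi x = 0 <-> exists y, x = g * y).
Proof.
case=> I [f [memI [f' fK f'K]]].
pose p (x : R) : F := f (\pi_{ideal_quot I} x).
have pB : zmod_morphism p.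
  by move=> x y; rewrite /p Quotient.pi_add Quotient.pi_opp -rmorphB.
have pM : monoid_morphism p.
  split=> [|x y]; last by rewrite /p Quotient.pi_mul -rmorphM.
  (* The unit of the quotient ring is a locked copy of the class of 1. *)
  by rewrite /p -(rmorph1 f); congr (f _); exact: lock.
pose pi : {rmorphism R -> F} := HB.pack p
  (GRing.isZmodMorphism.Build R F p pB) (GRing.isMonoidMorphism.Build R F p pM).
exists pi; split=> [y | x].
  by exists (repr (f' y)); rewrite /= /p reprK f'K.
have piE0 : (pi x == 0) = (x \in principal_ideal g).
  rewrite -memI -[x in x \in I]subr0 Quotient.idealrBE -(can_eq fK) /= /p.
  by rewrite -[0 in LHS](rmorph0 f); congr (_ == f _); exact: esym (lock _).
split=> [px0 | [y xE]].
  have /imsetP[y _ ->] : x \in principal_ideal g by rewrite -piE0; apply/eqP.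
  by exists y.
by apply/eqP; rewrite [_ == _]piE0 xE imset_f.
Qed.

(** Translation by 1 permutes [F], so adding 1 to every term leaves the sum of all elements
    unchanged. *)
Lemma natr_card_eq0 (F : finFieldType) : #|F|%:R = 0 :> F.
Proof.
apply: (addrI (\sum_(x : F) x)); rewrite addr0 -sumr_const -big_split /=.
by rewrite [RHS](reindex_inj (addIr 1)).
Qed.

(** The nonzero elements are q - 1 distinct roots of X^(q-1) - 1, so one of them is primitive of
    order q - 1; a suitable power has order n. *)
Lemma finField_prim_root (F : finFieldType) (n : nat) :
  (0 < n)%N -> (n %| #|F|.-1)%N -> exists z : F, n.-primitive_root z.
Proof.
move=> n_gt0 dvd_n.
have F1 : (0 < #|F|.-1)%N by rewrite -subn1 subn_gt0 finNzRing_gt1.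
have /hasP[z _ z_prim] : has #|F|.-1.-primitive_root (enum [pred x : F | x != 0]).
  apply: has_prim_root => //; last by rewrite -cardE (cardC1 (0 : F)).
    apply/allP=> x; rewrite mem_enum inE => x0; apply/unity_rootP.
    apply: (mulfI x0); rewrite -exprS prednK ?expf_card ?mulr1 //.
    by rewrite ltnW ?finNzRing_gt1.
  exact: enum_uniq.
by exists (z ^+ (#|F|.-1 %/ n)); apply: dvdn_prim_root.
Qed.

(** Hockey-stick identity; in the count, i will be the valuation of the first entry. *)
Lemma sum_bin_diag n j : (\sum_(i < j.+1) 'C(n + (j - i), n) = 'C(n.+1 + j, n.+1))%N.
Proof.
elim: j => [|j IHj]; first by rewrite big_ord1 subn0 !addn0 !binn.
by rewrite big_ord_recl subn0 IHj [in RHS]addSn binS addnC addSnnS.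
Qed.

(** * Recursion for tuples with a given product *)

Section TupleProducts.
Variable R : finComNzRingType.
Implicit Type z : R.

Definition tuple_products n z := #|[set t : n.-tuple R | \prod_(x <- t) x == z]|.

Lemma tuple_productsS n z :
  tuple_products n.+1 z =
    (\sum_(b : R) \sum_(w : R | (b * w)%R == z) tuple_products n w)%N.
Proof.
rewrite /tuple_products -sum1_card.
pose f (p : R * n.-tuple R) := [tuple of p.1 :: p.2].
have f_bij : bijective f.
  exists (fun t => (thead t, [tuple of behead t])) => [[x t] | t].
    by congr (_, _); apply: val_inj.
  by rewrite [RHS]tuple_eta; apply: val_inj.
rewrite (reindex f) /=; last exact: onW_bij.
under eq_bigl => p do rewrite inE /= big_cons.
rewrite -(pair_big_dep predT
  (fun b (t : n.-tuple R) => b * \prod_(x <- t) x == z) (fun _ _ => 1%N)) /=.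
apply: eq_bigr => b _.
rewrite (partition_big (fun t : n.-tuple R => \prod_(x <- t) x)
  (fun w => b * w == z)) //=.
apply: eq_bigr => w /eqP bw; rewrite -sum1_card; apply: eq_bigl => t.
by rewrite inE andbC; case: eqP => //= ->; rewrite bw eqxx.
Qed.

Lemma tuple_products1 z : tuple_products 1 z = 1%N.
Proof.
rewrite /tuple_products -[RHS](cards1 [tuple z]);
apply: eq_card => -[[|x [|y t]] //= sz].
by rewrite !inE -val_eqE /= big_seq1 eqseq_cons andbT.
Qed.

End TupleProducts.

(** * Lifting units and roots of unity from the residue field *)

Section LocalRing.
Variables (R : finComNzRingType) (F : finFieldType) (pi : {rmorphism R -> F}).
Variables (g : R) (e : nat).
Hypothesis pi_surj : forall y, exists x, pi x = y.
Hypothesis pi_ker : forall x, pi x = 0 <-> exists y, x = g * y.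
Hypothesis ge0 : g ^+ e = 0.

Local Notation q := #|F|.

(** Lifting the inverse of [pi x] gives y with 1 - x y nilpotent; a finite geometric series then
    inverts x y. *)
Lemma unit_of_residue x : pi x != 0 -> exists y, x * y = 1.
Proof.
move=> px0; have [y py] := pi_surj (pi x)^-1.
have [z xyE] : exists z, 1 - x * y = g * z.
  by apply/pi_ker; rewrite rmorphB rmorph1 rmorphM py divff ?subrr.
exists (y * \sum_(i < e) (g * z) ^+ i).
rewrite mulrA -[x * y](subKr 1) xyE -opprB mulNr -subrX1.
by rewrite exprMn ge0 mul0r sub0r opprK.
Qed.

Lemma residue_generator : pi g = 0.
Proof. by apply/pi_ker; exists 1; rewrite mulr1. Qed.

(** In a^q - b^q = (a - b) S, the sum S has residue q b^(q-1) = 0, which supplies one more factor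
    [g]. *)
Lemma expr_card_congr k a b c :
  a - b = g ^+ k.+1 * c -> exists d, a ^+ q - b ^+ q = g ^+ k.+2 * d.
Proof.
move=> abE; rewrite subrXX abE.
have pab : pi a = pi b.
  apply/eqP; rewrite -subr_eq0 -rmorphB abE rmorphM rmorphXn.
  by rewrite residue_generator expr0n mul0r.
have [d ->] : exists d, \sum_(i < q) a ^+ (q.-1 - i) * b ^+ i = g * d.
  apply/pi_ker; rewrite rmorph_sum /=.
  rewrite (eq_bigr (fun=> pi b ^+ q.-1)) => [|i _].
    by rewrite sumr_const card_ord -mulr_natr natr_card_eq0 mulr0.
  rewrite rmorphM !rmorphXn pab -exprD subnK // -ltnS prednK //.
  exact: ltnW (finNzRing_gt1 F).
by exists (c * d); rewrite mulrACA -exprSr.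
Qed.

Lemma expr_card_iter_congr m a b :
  pi a = pi b -> exists d, a ^+ (q ^ m) - b ^+ (q ^ m) = g ^+ m.+1 * d.
Proof.
move=> pab; elim: m => [|m [c /expr_card_congr[d dE]]].
  by rewrite !expr1; apply/pi_ker; rewrite rmorphB pab subrr.
by exists d; rewrite expnSr !exprM.
Qed.

Lemma lift_prim_root n z : n.-primitive_root z ->
  exists w, w ^+ n = 1 /\ pi w = z.
Proof.
move=> z_prim; have [x xz] := pi_surj z.
have [|d dE] := @expr_card_iter_congr e (x ^+ n) 1.
  by rewrite rmorphXn xz rmorph1 prim_expr_order.
exists (x ^+ (q ^ e)); split.
  apply/eqP; rewrite -subr_eq0 exprAC.
  by move: dE; rewrite expr1n exprS ge0 mulr0 mul0r => ->.
(* The q-th power map is the identity on [F], so the residue is still z. *)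
rewrite rmorphXn xz; elim: e => [|m IHm]; first exact: expr1.
by rewrite expnSr exprM IHm expf_card.
Qed.

(** * Fourier diagonalization of circulant matrices *)

Section Fourier.
Variables (n : nat) (w : R).
Hypothesis n_dvd : (n %| q.-1)%N.
Hypothesis w_expn : w ^+ n = 1.
Hypothesis w_prim : n.-primitive_root (pi w).

Local Notation is_unit x := (exists y : R, x * y = 1).

Definition dft : 'M[R]_n := \matrix_(j, k) w ^+ (j * k).

(** If n vanished in [F], so would its multiple q - 1, and q = 0 in [F] would give 1 = 0. *)
Lemma natr_is_unit : is_unit n%:R.
Proof.
apply: unit_of_residue; rewrite rmorph_nat.
have /dvdnP[m qE] := n_dvd.
apply/eqP=> n0; have /eqP := natr_card_eq0 F.
rewrite -(prednK (ltnW (finNzRing_gt1 F))) qE -addn1 natrD natrM n0 mulr0 add0r.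
by rewrite oner_eq0.
Qed.

Lemma dft_unit : exists W, dft *m W = n%:R%:M.
Proof.
(* The conjugate Fourier matrix: [n - l] stands for the exponent -l, as w^n = 1. *)
exists (\matrix_(k, l) w ^+ (k * (n - l))).
apply/matrixP=> j l; rewrite !mxE.
rewrite (eq_bigr (fun k : 'I_n => (w ^+ (j + (n - l))) ^+ k)) => [|k _]; last first.
  by rewrite !mxE -exprD -exprM [(j * k)%N]mulnC -mulnDr mulnC.
case: eqVneq => [->|j_neq_l].
  rewrite subnKC ?(ltnW (ltn_ord l)) // w_expn.
  rewrite (eq_bigr (fun=> 1)) => [|k _]; last by rewrite expr1n.
  by rewrite sumr_const card_ord.
have [|y wy] := @unit_of_residue (w ^+ (j + (n - l)) - 1).
  rewrite rmorphB rmorph1 rmorphXn subr_eq0.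
  apply: contraNneq j_neq_l => pjl.
  have : pi w ^+ (j + (n - l) + l) == pi w ^+ l by rewrite exprD pjl mul1r.
  rewrite -addnA subnK ?(ltnW (ltn_ord l)) // exprD (prim_expr_order w_prim).
  by rewrite mulr1 (eq_prim_root_expr w_prim) !modn_small.
(* With r = w^(j+n-l), the unit r - 1 times the geometric sum is r^n - 1 = 0. *)
by rewrite -[LHS]mul1r -wy mulrAC -subrX1 exprAC w_expn expr1n subrr mul0r.
Qed.

Lemma det_dft_unit : is_unit (\det dft).
Proof.
have [W VW] := dft_unit; have [m nm] := natr_is_unit.
exists (\det W * m ^+ n).
by rewrite mulrA -det_mulmx VW det_scalar -exprMn nm expr1n.
Qed.

Lemma mulmx_dft_inj : injective (fun a : 'rV[R]_n => a *m dft).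
Proof.
have [W VW] := dft_unit; have [m nm] := natr_is_unit.
apply: (can_inj (g := fun b => m *: (b *m W))) => a.
by rewrite -mulmxA VW mul_mx_scalar scalerA mulrC nm scale1r.
Qed.

(** One shift multiplies the k-th Fourier coefficient by w^k. Hence the columns of [dft] are common
    eigenvectors of all circulant matrices. *)
Lemma iter_right_shift_dft i (a : 'rV[R]_n) k :
  (iter i (@right_shift R n) a *m dft) 0 k = w ^+ (i * k) * (a *m dft) 0 k.
Proof.
elim: i => [|i IHi]; first by rewrite mul1r.
rewrite mulSn exprD -mulrA -IHi [iter _ _ _]/=.
move: (iter i _ a) => v; rewrite !mxE mulr_sumr.
rewrite (reindex_inj (can_inj (@ordSK n))) /=.
apply: eq_bigr => j _; rewrite !mxE ordSK mulrCA; congr (_ * _).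
(* [ordS] reduces j + 1 modulo n; w^n = 1 absorbs the wrap-around. *)
by rewrite exprM expr_mod // -exprM mulSn exprD.
Qed.

Lemma cir_mul_dft (a : 'rV[R]_n) : cir a *m dft = dft *m diag_mx (a *m dft).
Proof.
apply/matrixP=> i k; rewrite mul_mx_diag [in RHS]mxE.
rewrite [dft i k]mxE -iter_right_shift_dft !mxE.
by apply: eq_bigr => j _; rewrite !mxE.
Qed.

Lemma det_cir (a : 'rV[R]_n) : \det (cir a) = \prod_k (a *m dft) 0 k.
Proof.
have [y Vy] := det_dft_unit.
have /(congr1 (fun A => \det A * y)) := cir_mul_dft a.
by rewrite !det_mulmx det_diag -mulrA [RHS]mulrAC Vy mulr1 mul1r.
Qed.

Lemma cir_inj : injective (@cir R n).
Proof.
have n_gt0 := prim_order_gt0 w_prim.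
move=> a b /(congr1 (row (Ordinal n_gt0))).
by rewrite !rowK.
Qed.

Lemma num_circulant_prod (d : R) : num_circulant n d = tuple_products n d.
Proof.
pose h (a : 'rV[R]_n) := [tuple (a *m dft) 0 k | k < n].
have h_bij : bijective h.
  apply: inj_card_bij; last by rewrite card_tuple card_mx mul1n.
  move=> a b /(congr1 (fun t => tnth t)) ab; apply: mulmx_dft_inj.
  by apply/rowP=> k; have := congr1 (@^~ k) ab; rewrite !tnth_mktuple.
rewrite /tuple_products -(on_card_preimset (onW_bij _ h_bij)).
rewrite -(card_imset _ cir_inj).
apply: eq_card => A; rewrite !inE; apply/andP/imsetP.
  case=> /existsP[a /eqP->] /eqP <-; exists a => //.
  rewrite !inE big_tuple det_cir; apply/eqP.
  by apply: eq_bigr => k _; rewrite tnth_mktuple.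
case=> a; rewrite !inE big_tuple => /eqP <- ->.
split; first by apply/existsP; exists a.
by rewrite det_cir; apply/eqP/eq_bigr => k _; rewrite tnth_mktuple.
Qed.

End Fourier.

(** * Valuation layers and the count of products *)

Section Counting.
Hypothesis g_neq0 : forall k, (k < e)%N -> g ^+ k != 0.

Local Notation P k := (principal_ideal (g ^+ k)).
(* The elements of valuation [k], for [k < e]. *)
Definition layer k : {set R} := P k :\: P k.+1.
Definition annihilator (b : R) : {set R} := [set z | b * z == 0].
Definition residue_units : {set R} := [set u | pi u != 0].

Lemma mem_powers k x : reflect (exists y, x = g ^+ k * y) (x \in P k).
Proof. by apply: (iffP imsetP) => [[y _ ->] | [y ->]]; exists y. Qed.

Lemma mulr_unit_eq0 x u : pi u != 0 -> x * u = 0 -> x = 0.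
Proof.
move=> /unit_of_residue[v uv] xu.
by rewrite -[x]mulr1 -uv mulrA xu mul0r.
Qed.

Lemma mem_layer k x : (k < e)%N ->
  reflect (exists2 u, pi u != 0 & x = g ^+ k * u) (x \in layer k).
Proof.
move=> lt_ke; rewrite inE.
apply: (iffP andP) => [[xS /mem_powers[u xE]] | [u pu ->]].
  exists u => //; apply: contra xS => /eqP/pi_ker[y uE].
  by apply/mem_powers; exists y; rewrite xE uE exprSr mulrA.
split; last by apply/mem_powers; exists u.
(* If g^k u = g^(k+1) y, then g^k kills the unit u - g y, so g^k = 0, contradicting k < e. *)
apply/mem_powers=> -[y]; rewrite exprSr -mulrA => /eqP.
rewrite -subr_eq0 -mulrBr => /eqP /mulr_unit_eq0 gk.
have /eqP[] := g_neq0 lt_ke; apply: gk.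
by rewrite rmorphB rmorphM residue_generator mul0r subr0.
Qed.

(** Induction on i: if t = g^i y with y a unit and k + i < e, then g^k t = 0 would force g^(k+i) =
    0; so [g] divides y. *)
Lemma annihilator_powers k i t : (k + i <= e)%N -> g ^+ k * t = 0 -> t \in P i.
Proof.
move=> le_kie gt; elim: i le_kie => [|i IHi] lt_kie.
  by apply/mem_powers; exists t; rewrite mul1r.
rewrite addnS in lt_kie; have /mem_powers[y tE] := IHi (ltnW lt_kie).
have [/pi_ker[z yE] | py] := eqVneq (pi y) 0.
  by apply/mem_powers; exists z; rewrite tE yE exprSr mulrA.
have /eqP[] := g_neq0 lt_kie; apply: (mulr_unit_eq0 py).
by rewrite exprD -mulrA -tE.
Qed.

(** If g^k z = g^(k+j) u, then g^k kills z - g^j u, which therefore lies in [P j.+1]; such a term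
    only changes u by a multiple of [g]. *)
Lemma mul_layer k j z : (k + j < e)%N ->
  g ^+ k * z \in layer (k + j) -> z \in layer j.
Proof.
move=> lt_kje; have lt_je := leq_ltn_trans (leq_addl k j) lt_kje.
case/(mem_layer _ lt_kje)=> u pu; rewrite exprD -mulrA => /eqP.
rewrite -subr_eq0 -mulrBr => /eqP /(@annihilator_powers k j.+1).
rewrite addnS => /(_ lt_kje) /mem_powers[y zE].
apply/(mem_layer _ lt_je); exists (u + g * y).
  by rewrite rmorphD rmorphM residue_generator mul0r addr0.
by rewrite mulrDr mulrA -exprSr -zE addrC subrK.
Qed.

(** The solutions form the coset of the annihilator through [z0]. *)
Lemma card_solutions b z0 : #|[set z | b * z == b * z0]| = #|annihilator b|.
Proof.
rewrite -[RHS](card_imset _ (addrI z0)); apply: eq_card => z; rewrite !inE.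
apply/eqP/imsetP => [bz | [t]].
  by exists (z - z0); rewrite ?inE ?mulrBr ?bz ?subrr // addrC subrK.
by rewrite inE => /eqP bt ->; rewrite mulrDr bt addr0.
Qed.

Lemma annihilator_mul_unit b u : pi u != 0 -> annihilator (b * u) = annihilator b.
Proof.
move=> pu; apply/setP=> z; rewrite !inE -mulrA [u * z]mulrC mulrA.
by apply/eqP/eqP => [/mulr_unit_eq0 -> // | ->]; rewrite mul0r.
Qed.

(** Multiplication by g^k maps the units onto the layer. Each fibre is a full coset of the
    annihilator, because any solution z of g^k z = g^k u is again a unit. *)
Lemma card_layer k : (k < e)%N ->
  (#|layer k| * #|annihilator (g ^+ k)|)%N = #|residue_units|.
Proof.
move=> lt_ke; rewrite -[RHS]sum1_card.
rewrite (partition_big (fun u => g ^+ k * u) (mem (layer k))) => [|u] /=; last first.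
  by rewrite inE => pu; apply/(mem_layer _ lt_ke); exists u.
rewrite -sum_nat_const; apply: eq_bigr => x /(mem_layer _ lt_ke)[u pu ->].
rewrite sum1dep_card -(card_solutions _ u); apply: eq_card => z.
rewrite !inE andbC; case: eqP => //= gz.
have : z \in layer 0.
  apply: (@mul_layer k); rewrite addn0 // gz.
  by apply/(mem_layer _ lt_ke); exists u.
have e_gt0 : (0 < e)%N := leq_ltn_trans (leq0n k) lt_ke.
by case/(mem_layer _ e_gt0)=> v pv ->; rewrite mul1r.
Qed.

(** Multiplication by [g] maps [P k] onto [P k.+1], and its kernel lies in [P k] because k < e. *)
Lemma card_powersS k : (k < e)%N -> #|P k| = (#|P k.+1| * #|annihilator g|)%N.
Proof.
move=> lt_ke; rewrite -[LHS]sum1_card.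
rewrite (partition_big (fun x => g * x) (mem (P k.+1))) => [|x] /=; last first.
  case/mem_powers=> y ->; apply/mem_powers; exists y.
  by rewrite mulrA -exprS.
rewrite -sum_nat_const; apply: eq_bigr => _ /mem_powers[y ->].
rewrite exprS -mulrA sum1dep_card -(card_solutions _ (g ^+ k * y)).
apply: eq_card => x; rewrite !inE andbC; case: eqP => //= gx.
have /mem_powers[t xE] : x - g ^+ k * y \in P k.
  by apply: (@annihilator_powers 1) => //; rewrite expr1 mulrBr gx subrr.
by apply/mem_powers; exists (y + t); rewrite mulrDr -xE addrC subrK.
Qed.

Lemma card_powers k : (k <= e)%N -> #|P (e - k)| = (#|annihilator g| ^ k)%N.
Proof.
elim: k => [|k IHk] lt_ke.
  rewrite subn0 ge0 expn0 -(cards1 (0 : R)); apply: eq_card => x; rewrite inE.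
  by apply/imsetP/eqP => [[y _ ->] | ->]; [|exists 0]; rewrite ?mul0r.
have e_gt0 : (0 < e)%N := leq_ltn_trans (leq0n k) lt_ke.
by rewrite card_powersS ?ltn_subrL // subnSK // IHk ?expnSr // ltnW.
Qed.

Lemma card_residue_fibres : #|R| = (q * #|P 1|)%N.
Proof.
rewrite -[LHS]sum1_card (partition_big pi predT) //= -sum_nat_const.
apply: eq_bigr => y _; have [x0 <-] := pi_surj y.
rewrite sum1dep_card -[RHS](card_imset _ (addrI x0)); apply: eq_card => x.
rewrite !inE; apply/eqP/imsetP => [px | [t /mem_powers[z ->] ->]].
  exists (x - x0); last by rewrite addrC subrK.
  by apply/mem_powers; rewrite expr1; apply/pi_ker; rewrite rmorphB px subrr.
by rewrite rmorphD rmorphM rmorphXn residue_generator mul0r addr0.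
Qed.

Lemma exponent_gt0 : (0 < e)%N.
Proof. by case: e ge0 => // /eqP; rewrite expr0 oner_eq0. Qed.

(** With a the size of the annihilator, |R| is both a^e and q a^(e-1); cancel, since a > 0. *)
Lemma card_annihilator : #|annihilator g| = q.
Proof.
have := card_residue_fibres.
have -> : #|R| = #|P (e - e)|.
  rewrite subnn; apply: eq_card => x; rewrite inE; apply/esym/mem_powers.
  by exists x; rewrite mul1r.
have -> : 1%N = (e - e.-1)%N by rewrite -[in RHS](prednK exponent_gt0) subSnn.
rewrite !card_powers ?leq_pred // -{1}(prednK exponent_gt0) expnS => /eqP.
rewrite eqn_pmul2r ?expn_gt0; first by move/eqP.
by apply/orP; left; apply/card_gt0P; exists 0; rewrite inE mulr0.
Qed.

Lemma card_residue_units : #|residue_units| = (q ^ e.-1 * q.-1)%N.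
Proof.
have cardP1 : #|P 1| = (q ^ e.-1)%N.
  have -> : 1%N = (e - e.-1)%N by rewrite -[in RHS](prednK exponent_gt0) subSnn.
  by rewrite card_powers ?leq_pred // card_annihilator.
have -> : residue_units = ~: P 1.
  apply/setP=> x; rewrite !inE; congr (~~ _).
  by apply/eqP/mem_powers; rewrite expr1 => /pi_ker.
by rewrite cardsCs setCK card_residue_fibres cardP1 -[q.-1]subn1 mulnBr muln1 mulnC.
Qed.

Lemma sum_layers (G : R -> nat) k :
  (\sum_b G b = \sum_(i < k) \sum_(b in layer i) G b + \sum_(b in P k) G b)%N.
Proof.
elim: k => [|k ->].
  rewrite big_ord0; apply: eq_bigl => b; apply/esym/mem_powers.
  by exists b; rewrite mul1r.
rewrite big_ord_recr -addnA /=; congr (_ + _)%N.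
rewrite (big_setID (P k.+1)) /= addnC.
congr (_ + _)%N.
apply: eq_bigl => b; rewrite inE andbC; case: mem_powers => //= -[y ->].
by apply/mem_powers; exists (g * y); rewrite mulrA -exprSr.
Qed.

Lemma tuple_products_layer n j z : (j < e)%N -> z \in layer j ->
  tuple_products n.+1 z = (#|residue_units| ^ n * 'C(n + j, n))%N.
Proof.
elim: n j z => [|n IHn] j z lt_je zj; first by rewrite tuple_products1 bin0.
rewrite tuple_productsS (sum_layers _ j.+1).
have zjP := zj; rewrite inE in zjP; case/andP: zjP => zNS _.
(* A first entry in [P j.+1] would put z there too, so only valuations up to j contribute. *)
rewrite [X in (_ + X)%N]big1 => [|b /mem_powers[y ->]]; last first.
  rewrite big1 // => w /eqP zE; case/mem_powers: zNS.
  by exists (y * w); rewrite mulrA zE.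
rewrite addn0 -sum_bin_diag big_distrr; apply: eq_bigr => -[i /= le_ij] _.
rewrite ltnS in le_ij; have lt_ie := leq_ltn_trans le_ij lt_je.
have lt_jie : (j - i < e)%N := leq_ltn_trans (leq_subr i j) lt_je.
rewrite expnS -{1}(card_layer lt_ie) -!mulnA -sum_nat_const.
apply: eq_bigr => b /(mem_layer _ lt_ie)[u pu bE].
have [v uv] := unit_of_residue pu.
have pv : pi v != 0.
  apply: contraNneq (oner_neq0 F) => pv0.
  by rewrite -(rmorph1 pi) -uv rmorphM pv0 mulr0.
have [u' pu' zE] := mem_layer _ lt_je zj.
(* An explicit solution of b w = z, so that [card_solutions] counts all of them. *)
have bz : b * (v * (g ^+ (j - i) * u')) = z.
  by rewrite bE mulrA -[_ * u * v]mulrA uv mulr1 mulrA -exprD subnKC // zE.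
rewrite -(annihilator_mul_unit _ pu) -bE.
rewrite -(card_solutions b (v * (g ^+ (j - i) * u'))).
rewrite -sum_nat_const; apply: eq_big => w; first by rewrite inE bz.
move=> /eqP bw; apply: IHn => //.
(* Every solution w has valuation j - i: cancel g^i, then undo the unit u. *)
have : u * w \in layer (j - i).
  by apply: (@mul_layer i); rewrite subnKC // mulrA -bE bw.
case/(mem_layer _ lt_jie) => t pt uwE; apply/(mem_layer _ lt_jie).
exists (v * t); first by rewrite rmorphM mulf_neq0.
by rewrite mulrCA -uwE mulrA [v * u]mulrC uv mul1r.
Qed.

End Counting.

End LocalRing.

Theorem theorem4p9 (R : finComNzRingType) (hR : chain_ring R)
    (gamma : R) (hgamma : maximal_ideal (principal_ideal gamma))
    (e : nat) (he : nilpotency_index gamma e)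
    (F : finFieldType) (hF : residue_field gamma F)
    (q : nat) (hq : #|F| = q)
    (s : nat) (hs : (1 <= s)%N /\ (s < e)%N)
    (n : nat) (hn : (0 < n)%N) (hnq : (n %| q - 1)%N) :
  num_circulant n (gamma ^+ s)%R =
    (q ^ ((e - 1) * (n - 1)) * (q - 1) ^ (n - 1) * 'C(n + s - 1, n - 1))%N.
Proof.
have [pi [pi_surj pi_ker]] := residue_morphism hF.
case: he hs => e_gt0 ge0 e_min [_ lt_se]; case: n hn hnq => // m _.
rewrite -hq !subn1 addSn /= => m_dvd.
have g_neq0 k : (k < e)%N -> (gamma ^+ k != 0)%R.
  (* Minimality of e only concerns positive exponents; exponent 0 is 1 != 0. *)
  case: k => [_ | k lt_ke]; first by rewrite expr0 oner_neq0.
  by apply/eqP=> /(e_min k.+1 isT); rewrite leqNgt lt_ke.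
have [z z_prim] := finField_prim_root (ltn0Sn m) m_dvd.
have [w [w_expn pi_w]] := lift_prim_root pi_surj pi_ker ge0 z_prim.
rewrite -pi_w in z_prim.
rewrite (num_circulant_prod pi_surj pi_ker ge0 m_dvd w_expn z_prim).
have -> := @tuple_products_layer _ _ pi _ _ pi_surj pi_ker ge0 g_neq0 m s.
- by rewrite (card_residue_units pi_surj pi_ker ge0 g_neq0) expnMn -expnM.
- exact: lt_se.
apply/(mem_layer pi_surj pi_ker ge0 g_neq0 _ lt_se); exists 1%R.
  by rewrite rmorph1 oner_neq0.
by rewrite mulr1.
Qed.
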